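(* Let $q\in(0,1)$ and consider $\pi_1$ under the measure $\mathcal{P}_n^{(q)}$. Then $$\lim_{n\to\infty}\mathcal{P}_n^{(q)}(\pi_1=k)=(1-q)q^{k-1},\quad k\in\mathbb{N}=\{1,2,\ldots\}.$$ That is, $\pi_1$ converges in distribution to the geometric distribution with parameter $1-q$.
   Context: Write $[n]=\{1,\ldots,n\}$ and let $S_n$ be the set of permutations of $[n]$, written in one-line notation $\sigma=\sigma_1\cdots\sigma_n$; $\sigma^{-1}_k$ is the position of $k$ in $\sigma$. A parking function of length $n$ is a sequence $\pi=(\pi_1,\ldots,\pi_n)\in[n]^n$ with $|\{i:\pi_i\le j\}|\ge j$ for all $j\in[n]$; $PF_n$ is the set of these. The inversion statistic is $I_n(\sigma)=\sum_{1\le i<j\le n}1_{\sigma_j<\sigma_i}$. For $j\in[n]$ let $I_{n,<j}(\sigma)=\sum_{1\le i<j}1_{\sigma^{-1}_j<\sigma^{-1}_i}$ (the number of inversions of $\sigma$ involving $j$ and a number less than $j$) and $\tilde I_{n,<j}=I_{n,<j}+1$. For $q\in(0,\infty)$, the Mallows measure on $S_n$ is $P_n^{(q)}(\sigma)=q^{I_n(\sigma)}/K_n$, where $K_n=\sum_{\rho\in S_n}q^{I_n(\rho)}$ is the normalizing constant; $P_n$ denotes the uniform measure on $S_n$. The map $(\sigma,\tau)\mapsto(\tilde I_{n,<\tau_1}(\sigma),\ldots,\tilde I_{n,<\tau_n}(\sigma))$ sends $S_n\times S_n$ into $PF_n$, and $\mathcal{P}_n^{(q)}$ denotes the probability measure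 on $PF_n$ that is the image of $P_n^{(q)}\times P_n$ under this map. $\pi_1$ denotes the first coordinate of the random parking function $\pi=(\pi_1,\ldots,\pi_n)\in PF_n$ (the dependence on $n$ is suppressed). *)

(* Defs.v *)
From HB Require Import structures.
From mathcomp Require Import all_boot all_order all_fingroup all_algebra.
From mathcomp Require Import all_classical all_reals all_analysis.

Set Implicit Arguments.
Unset Strict Implicit.
Unset Printing Implicit Defensive.
Import Order.TTheory GRing.Theory Num.Theory.
Import numFieldNormedType.Exports.
Local Open Scope classical_set_scope.
Local Open Scope ring_scope.

(* The label and the position i + 1 of [n] are both represented by i : 'I_n,
   so sigma_(i + 1) = (s i) + 1 and sigma^-1_(k + 1) = (s^-1 k) + 1 for
   s : 'S_n. Comparisons are unaffected by these shifts. *)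

Definition inversions (n : nat) (s : 'S_n) : nat :=
  (\sum_(i < n) \sum_(j < n | (i < j)%N) (s j < s i)%N)%N.

Definition inv_below (n : nat) (j : 'I_n) (s : 'S_n) : nat :=
  (\sum_(i < n | (i < j)%N) ((s^-1)%g j < (s^-1)%g i)%N)%N.

Definition tilde_inv_below (n : nat) (j : 'I_n) (s : 'S_n) : nat :=
  (inv_below j s).+1.

Lemma tilde_inv_below_le (n : nat) (j : 'I_n) (s : 'S_n) :
  (tilde_inv_below j s <= j.+1)%N.
Proof.
rewrite ltnS /inv_below -[leqRHS](card_ord j) -sum1_card.
rewrite (big_ord_widen n (fun=> 1%N)) ?(ltnW (ltn_ord j))//.
by apply: leq_sum => i _; case: (_ < _)%N.
Qed.

(* The entries are not shifted: an element of [n] is here a nonzero value of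
   'I_n.+1 = {0, ..., n}. The condition at j = 0 is vacuous. *)
Definition is_parking (n : nat) (p : n.-tuple 'I_n.+1) : bool :=
  all (fun x : 'I_n.+1 => (0 < x)%N) p &&
  [forall j : 'I_n.+1, (j <= #|[set i : 'I_n | (tnth p i <= j)%N]%SET|)%N].

Notation PF n := {p : n.-tuple 'I_n.+1 | is_parking p}.

Definition parking_tuple (n : nat) (st : 'S_n * 'S_n) : n.-tuple 'I_n.+1 :=
  [tuple inord (tilde_inv_below (st.2 i) st.1) | i < n].

Lemma tnth_parking_tuple (n : nat) (st : 'S_n * 'S_n) (i : 'I_n) :
  tnth (parking_tuple st) i = tilde_inv_below (st.2 i) st.1 :> nat.
Proof.
rewrite tnth_mktuple inordK// ltnS.
exact: leq_trans (tilde_inv_below_le _ _) (ltn_ord _).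
Qed.

Lemma parking_tupleP (n : nat) (st : 'S_n * 'S_n) :
  is_parking (parking_tuple st).
Proof.
apply/andP; split.
  by apply/all_tnthP => i; rewrite tnth_parking_tuple.
apply/forallP => j.
have {1}-> : j = #|[set i : 'I_n | (st.2 i < j)%N]%SET| :> nat.
  have jn : (j <= n)%N by rewrite -ltnS ltn_ord.
  rewrite -sum1_card (eq_bigl (fun i => (st.2 i < j)%N)); last first.
    by move=> i; rewrite inE.
  rewrite -(@reindex_inj _ _ _ _ st.2 (fun i : 'I_n => (i < j)%N) (fun=> 1%N)
              perm_inj).
  by rewrite -(big_ord_widen n (fun=> 1%N) jn) sum1_card card_ord.
apply: subset_leq_card; apply/fintype.subsetP => i; rewrite !inE tnth_parking_tuple.
exact: leq_trans (tilde_inv_below_le _ _).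
Qed.

Definition parking_map (n : nat) (st : 'S_n * 'S_n) : PF n :=
  Sub (parking_tuple st) (parking_tupleP st).

(* Measures on a finite type are given by their weights on points. *)
Definition measure_of (R : realType) (T : finType) (mu : T -> R) (A : pred T)
  : R := \sum_(x | A x) mu x.

Definition mallows (R : realType) (q : R) (n : nat) (s : 'S_n) : R :=
  q ^+ inversions s / \sum_(r : 'S_n) q ^+ inversions r.

Definition uniform_perm (R : realType) (n : nat) (s : 'S_n) : R :=
  (#|'S_n|%:R)^-1.

Definition parking_mallows (R : realType) (q : R) (n : nat) (p : PF n) : R :=
  measure_of (fun st : 'S_n * 'S_n => mallows q st.1 * uniform_perm R st.2)
             (fun st => parking_map st == p).

(* The first entry; 0 when n = 0. *)
Definition first_entry (n : nat) (p : PF n) : nat := head ord0 (val p).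

Definition cdf_under (R : realType) (T : finType) (mu : T -> R) (X : T -> nat)
  (x : R) : R := measure_of mu (fun t => (X t)%:R <= x).

(* Geometric distribution on {1, 2, ...}. *)
Definition geometric_pmf (R : realType) (p : R) (k : nat) : R :=
  if k is k'.+1 then p * (1 - p) ^+ k' else 0.

Definition geometric_cdf (R : realType) (p : R) (x : R) : R :=
  limn (series (fun k => if k%:R <= x then geometric_pmf p k else 0)).

Definition cvg_in_distribution (R : realType) (F_ : nat -> R -> R)
    (F : R -> R) : Prop :=
  forall x : R, {for x, continuous F} -> F_ n x @[n --> \oo] --> F x.

(* Main.v *)
Require Import Defs.
From mathcomp Require Import all_boot all_order all_fingroup all_algebra.
From mathcomp Require Import all_classical all_reals all_analysis.
Set Implicit Arguments.
Unset Strict Implicit.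
Unset Printing Implicit Defensive.
Import Order.TTheory GRing.Theory Num.Theory.
Import numFieldNormedType.Exports.
Local Open Scope classical_set_scope.
Local Open Scope ring_scope.

(* The vector (I_{<j})_j is a Lehmer code: it is a bijection from S_n onto the
   product of the {0, ..., j} (labels j counted from 0), and its entries sum to
   the number of inversions. Hence under the Mallows measure I_{<j} has the
   geometric law of ratio q truncated to {0, ..., j}. As tau_1 is uniform,
   P(pi_1 = k + 1) is the Cesaro mean over j of q^k / (1 + q + ... + q^j), whose
   terms tend to (1 - q) q^k. *)

(** Each inversion is counted at its larger label; reindexing both sums along [s] turns pairs of
    labels into pairs of positions. *)
Lemma inversions_sum_inv_below (n : nat) (s : 'S_n) :
  inversions s = (\sum_(j < n) inv_below j s)%N.
Proof.
rewrite /inversions /inv_below.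
under eq_bigr do rewrite big_mkcond/=.
rewrite [RHS](reindex_inj (@perm_inj _ s)); apply: eq_bigr => i _.
rewrite [RHS]big_mkcond [RHS](reindex_inj (@perm_inj _ s)).
apply: eq_bigr => j _; rewrite !permK.
by case: (i < j)%N; case: (s j < s i)%N.
Qed.

Lemma inv_below_le (n : nat) (j : 'I_n) (s : 'S_n) : (inv_below j s <= j)%N.
Proof. exact: tilde_inv_below_le. Qed.

(* The relative order of the positions of i < j is thus a function of the code
   of j and of the relative order of the positions of the labels below j. *)
Lemma ltn_perm_inv_below (n : nat) (s : 'S_n) (i j : 'I_n) : (i < j)%N ->
  ((s^-1)%g j < (s^-1)%g i)%N =
  (\sum_(k < n | (k < j)%N) ((s^-1)%g i < (s^-1)%g k) < inv_below j s)%N.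
Proof.
move=> ij; rewrite /inv_below; set t := (s^-1)%g.
have [tji|tij] := ltnP (t j) (t i); apply/esym.
  (* Every label positioned after [i] is also after [j], and [i] itself is counted only on the
     right, so the inequality is strict. *)
  rewrite [X in (X < _)%N](bigD1 i)//= ltnn add0n.
  rewrite [X in (_ < X)%N](bigD1 i)//= tji.
  rewrite add1n ltnS; apply: leq_sum => k _.
  by case: ltnP => // /(ltn_trans tji) ->.
apply/negbTE; rewrite -leqNgt; apply: leq_sum => k _.
by case: ltnP => // /(leq_ltn_trans tij) ->.
Qed.

(** By induction on [m], the code determines the relative order of the positions of the labels below
    [m]. For [m = n] this order fixes the permutation. *)
Lemma inv_below_inj (n : nat) (s t : 'S_n) :
  (forall j, inv_below j s = inv_below j t) -> s = t.
Proof.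
move=> code_eq.
have cmp m : forall i j : 'I_n, (i < m)%N -> (j < m)%N ->
    ((s^-1)%g j < (s^-1)%g i)%N = ((t^-1)%g j < (t^-1)%g i)%N.
  elim: m => // m IH.
  have below (i j : 'I_n) : (i < j)%N -> (j < m.+1)%N ->
      ((s^-1)%g j < (s^-1)%g i)%N = ((t^-1)%g j < (t^-1)%g i)%N.
    move=> ij; rewrite ltnS => jm; rewrite !ltn_perm_inv_below// code_eq.
    congr (_ < _)%N; apply: eq_bigr => k kj.
    by rewrite IH ?(leq_trans ij) ?(leq_trans kj).
  move=> i j im jm; have [ij|ji|/val_inj->] := ltngtP i j.
  - exact: below.
  - have neq (u : 'S_n) : (u j == u i :> nat) = false.
      by rewrite val_eqE (inj_eq perm_inj) -val_eqE ltn_eqF.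
    by rewrite ltn_neqAle [in RHS]ltn_neqAle !neq/= leqNgt [in RHS]leqNgt below.
  - by rewrite !ltnn.
apply: invg_inj; apply/permP => i; apply: val_inj.
(* A value of a permutation is its rank among all the values, so comparisons alone recover it. *)
have rank (u : 'S_n) : u i = (\sum_(k < n) (u k < u i))%N :> nat.
  rewrite [RHS](_ : _ = \sum_(k < n) (k < u i))%N; last first.
    by rewrite [RHS](reindex_inj (@perm_inj _ u)).
  rewrite -[LHS]card_ord -sum1_card.
  by rewrite (big_ord_widen n (fun=> 1%N)) ?(ltnW (ltn_ord _))// big_mkcond.
by rewrite [LHS]rank [RHS]rank; apply: eq_bigr => k _; rewrite (cmp n).
Qed.

(** Summing over codes instead of permutations, distributivity factors the sum: the code entries are
    independent under any product weight. *)
Lemma sum_prod_inv_below (R : comPzSemiRingType) (n : nat)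
    (F : 'I_n -> nat -> R) :
  \sum_(s : 'S_n) \prod_(j < n) F j (inv_below j s) =
  \prod_(j < n) \sum_(k < j.+1) F j k.
Proof.
pose code (s : 'S_n) : {ffun 'I_n -> 'I_n} :=
  [ffun j => Ordinal (leq_ltn_trans (inv_below_le j s) (ltn_ord j))].
have code_inj : injective code.
  move=> s t /ffunP st; apply: inv_below_inj => j.
  by have := congr1 val (st j); rewrite !ffunE.
pose Q (j : 'I_n) : pred 'I_n := fun k => (k <= j)%N.
(* Surjectivity follows by counting: [code] is injective, and the family has $1\cdot 2\cdots n = n!$
   elements, by the same distributive law with all weights [1]. *)
have imcode : [set code s | s in [set: 'S_n]]%SET = [set f in family Q]%SET.
  apply/eqP; rewrite eqEcard; apply/andP; split.
    apply/fintype.subsetP => _ /imsetP[s _ ->]; rewrite inE.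
    by apply/familyP => j; rewrite ffunE; exact: inv_below_le.
  rewrite card_imset// cardsT card_Sn cardsE -sum1_card.
  rewrite (eq_bigr (fun f : {ffun 'I_n -> 'I_n} => \prod_(j < n) 1)%N);
      last first.
    by move=> f _; rewrite big1.
  rewrite -(bigA_distr_big_dep Q (fun _ _ => 1%N)) fact_prod big_add1 big_mkord.
  apply: leq_prod => j _.
  rewrite -[leqRHS](card_ord j.+1) -sum1_card (big_ord_widen n (fun=> 1%N))//.
transitivity (\sum_(f in [set code s | s in [set: 'S_n]]%SET)
    \prod_(j < n) F j (f j)).
  rewrite big_imset/=; last by move=> ? ? _ _; exact: code_inj.
  apply: eq_big => [s|s _]; first by rewrite inE.
  by apply: eq_bigr => j _; rewrite ffunE.
rewrite imcode (eq_bigl (mem (family Q))); last by move=> f; rewrite inE.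
rewrite -(bigA_distr_big_dep Q (fun j (k : 'I_n) => F j k)).
apply: eq_bigr => j _; rewrite (big_ord_widen n (F j))//.
Qed.

(** The $q$-integer $[m]_q$. *)
Definition qnum (R : pzSemiRingType) (q : R) (m : nat) : R :=
  \sum_(k < m) q ^+ k.

Lemma qnum_gt0 (R : numDomainType) (q : R) (m : nat) : 0 < q -> 0 < qnum q m.+1.
Proof.
move=> q0; rewrite /qnum big_ord_recl expr0 ltr_pwDl// sumr_ge0// => i _.
by rewrite exprn_ge0// ltW.
Qed.

Lemma qnumE (R : fieldType) (q : R) (m : nat) : q != 1 ->
  qnum q m = (1 - q ^+ m) / (1 - q).
Proof.
move=> q1; have q1' : 1 - q != 0 by rewrite subr_eq0 eq_sym.
by apply: (mulIf q1'); rewrite divfK// mulrC -opprB mulNr -subrX1 opprB /qnum.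
Qed.

(** The normalizing constant is the $q$-factorial $[n]_q!$. *)
Lemma sum_expr_inversions (R : comPzSemiRingType) (q : R) (n : nat) :
  \sum_(s : 'S_n) q ^+ inversions s = \prod_(j < n) qnum q j.+1.
Proof.
rewrite -(sum_prod_inv_below (fun _ k => q ^+ k)).
by apply: eq_bigr => s _; rewrite inversions_sum_inv_below -expr_sum.
Qed.

Lemma mallows_inv_below (R : realType) (q : R) (n : nat) (j : 'I_n) (i : nat) :
  0 < q ->
  measure_of (@mallows R q n) (fun s => inv_below j s == i) =
  if (i <= j)%N then q ^+ i / qnum q j.+1 else 0.
Proof.
move=> q0; rewrite /measure_of /mallows -mulr_suml.
(* The indicator of the event is absorbed into the factor at [j], which keeps the weight a product;
   all other factors then cancel against the $q$-factorial. *)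
rewrite big_mkcond (eq_bigr (fun s : 'S_n => \prod_(l < n)
    (if l == j then (if inv_below l s == i then q ^+ inv_below l s else 0)
     else q ^+ inv_below l s))); last first.
  move=> s _; rewrite (bigD1 j)//= eqxx inversions_sum_inv_below (bigD1 j)//=.
  rewrite exprD expr_sum.
  rewrite [X in _ = _ * X](eq_bigr (fun l => q ^+ inv_below l s)); last first.
    by move=> l /negbTE ->.
  by case: ifP => _; rewrite ?mul0r.
rewrite (sum_prod_inv_below (fun l k =>
    if l == j then (if k == i then q ^+ k else 0) else q ^+ k)).
rewrite sum_expr_inversions (bigD1 j)//= [X in _ / X](bigD1 j)//= eqxx.
under [X in _ * X / _]eq_bigr => l /negbTE lj do rewrite lj.
rewrite -mulf_div divff ?mulr1; last first.
  by apply/prodf_neq0 => l _; rewrite gt_eqF// qnum_gt0.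
rewrite -big_mkcond/=; case: ifPn => [ij|ij].
  by rewrite (big_pred1 (Ordinal (ij : (i < j.+1)%N))).
rewrite big_pred0 ?mul0r// => k; apply/negbTE; apply: contra ij => /eqP <-.
by rewrite -ltnS.
Qed.

(** Precomposing with a transposition shows that the sum is the same for every [i]; summed over all
    [i], each permutation contributes the total of [f]. *)
Lemma sum_perm_app (R : numFieldType) (n : nat) (f : 'I_n.+1 -> R)
    (i : 'I_n.+1) :
  \sum_(t : 'S_n.+1) f (t i) / #|'S_n.+1|%:R = n.+1%:R^-1 * \sum_j f j.
Proof.
have symm (k : 'I_n.+1) : \sum_(t : 'S_n.+1) f (t i) =
    \sum_(t : 'S_n.+1) f (t k).
  rewrite (reindex_inj (mulgI (tperm i k)))/=; apply: eq_bigr => t _.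
  by rewrite permM tpermL.
have S0 : #|'S_n.+1|%:R != 0 :> R by rewrite card_Sn pnatr_eq0 -lt0n fact_gt0.
rewrite -mulr_suml; apply: (mulfI (_ : n.+1%:R != 0 :> R));
  first by rewrite pnatr_eq0.
rewrite mulrA [RHS]mulrA divff ?pnatr_eq0// mul1r; apply: (canLR (mulfK S0)).
transitivity (\sum_(k < n.+1) \sum_(t : 'S_n.+1) f (t k)).
  by rewrite -(eq_bigr _ (fun k _ => symm k)) sumr_const card_ord mulr_natl.
rewrite exchange_big/= (eq_bigr (fun=> \sum_j f j)); last first.
  by move=> t _; rewrite [RHS](reindex_inj (@perm_inj _ t)).
by rewrite sumr_const mulr_natr.
Qed.

Lemma measure_of_image (R : realType) (S T : finType) (mu : S -> R) (f : S -> T)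
    (A : pred T) :
  measure_of (fun y => measure_of mu (fun x => f x == y)) A =
  measure_of mu (fun x => A (f x)).
Proof.
rewrite /measure_of [RHS](partition_big f A)//=; apply: eq_bigr => y Ay.
by apply: eq_bigl => x; case: eqP => [->|]; rewrite ?Ay ?andbF.
Qed.

Lemma first_entry_parking_map (n : nat) (st : 'S_n.+1 * 'S_n.+1) :
  first_entry (parking_map st) = tilde_inv_below (st.2 ord0) st.1.
Proof.
rewrite /first_entry -nth0 -(tnth_nth _ (parking_tuple st) ord0).
exact: tnth_parking_tuple.
Qed.

Lemma parking_mallows_first_entry (R : realType) (q : R) (n k : nat) : 0 < q ->
  measure_of (@parking_mallows R q n.+1) (fun p => first_entry p == k.+1) =
  n.+1%:R^-1 * \sum_(j < n.+1) if (k <= j)%N then q ^+ k / qnum q j.+1 else 0.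
Proof.
move=> q0; rewrite measure_of_image.
pose f (j : 'I_n.+1) :=
  measure_of (@mallows R q n.+1) (fun s => inv_below j s == k).
transitivity (n.+1%:R^-1 * \sum_j f j); last first.
  by congr (_ * _); apply: eq_bigr => j _; rewrite /f mallows_inv_below.
rewrite -(sum_perm_app f ord0) /measure_of /f.
under [RHS]eq_bigr do rewrite mulr_suml big_mkcond/=.
rewrite exchange_big/= pair_big/= big_mkcond/=; apply: eq_bigr => -[s t] _ /=.
by rewrite first_entry_parking_map.
Qed.

Lemma cvg_first_entry (R : realType) (q : R) (k : nat) : 0 < q -> q < 1 ->
  measure_of (parking_mallows q (n := n)) (fun p => first_entry p == k.+1)
    @[n --> \oo] --> (1 - q) * q ^+ k.
Proof.
move=> q0 q1; rewrite -cvg_shiftS.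
pose u (j : nat) : R := if (k <= j)%N then q ^+ k / qnum q j.+1 else 0.
(* The truncated geometric law at [j] does not depend on [n], so the probabilities are the Cesaro
   means of one fixed sequence. *)
rewrite (_ : (fun n => _) = arithmetic_mean u); last first.
  apply/funext => n; rewrite parking_mallows_first_entry//.
  by rewrite /arithmetic_mean/= /series/= big_mkord.
apply: cesaro.
have lim_u : (fun j : nat => (1 - q) * q ^+ k / (1 - q ^+ j.+1)) @ \oo -->
    (1 - q) * q ^+ k / (1 - 0).
  apply: cvgM; first exact: cvg_cst.
  apply: cvgV; first by rewrite subr0 oner_neq0.
  apply: cvgB; first exact: cvg_cst.
  rewrite (cvg_shiftS (fun j => q ^+ j)); apply: cvg_expr.
  by rewrite ger0_norm// ltW.
rewrite subr0 divr1 in lim_u; apply: cvg_trans lim_u.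
apply: near_eq_cvg; near=> j.
rewrite /u ifT; last by near: j; exact: nbhs_infty_ge.
by rewrite qnumE ?lt_eqF// invf_div mulrA [q ^+ k * _]mulrC.
Unshelve. all: by end_near. Qed.

Lemma first_entry_gt0 (n : nat) (p : PF n.+1) : (0 < first_entry p)%N.
Proof.
have /andP[/all_tnthP p0 _] := valP p.
by rewrite /first_entry -nth0 -(tnth_nth _ (val p) ord0); exact: p0.
Qed.

Lemma limn_series_finite (R : realType) (u : nat -> R) (N : nat) :
  (forall k, (N <= k)%N -> u k = 0) -> limn (series u) = \sum_(k < N) u k.
Proof.
move=> u0; apply: lim_near_cst => //; near=> m.
have Nm : (N <= m)%N by near: m; exact: nbhs_infty_ge.
rewrite /series/= (big_cat_nat (leq0n N) Nm)/= big_mkord.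
rewrite [X in _ + X]big_nat_cond [X in _ + X]big1 ?addr0//.
by move=> i /andP[/andP[Ni _] _]; exact: u0.
Unshelve. all: by end_near. Qed.

Theorem theorem4 (R : realType) (q : R) (hq0 : 0 < q) (hq1 : q < 1) :
  (forall k : nat, (1 <= k)%N ->
     measure_of (parking_mallows q (n := n)) (fun p => first_entry p == k)
       @[n --> \oo] --> (1 - q) * q ^+ (k - 1)) /\
  cvg_in_distribution
    (fun n => cdf_under (parking_mallows q (n := n)) (@first_entry n))
    (geometric_cdf (1 - q)).
Proof.
split=> [[//|k] _|x _]; first by rewrite subn1; exact: cvg_first_entry.
(* Every natural number at most [x] is below [N], so both distribution functions are sums over
   [k < N]. *)
pose N := (Num.truncn x).+1.
have xN k : (N <= k)%N -> (k%:R <= x) = false.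
  move=> Nk; apply/negbTE; rewrite -ltNge; apply: lt_le_trans (truncnS_gt x) _.
  by rewrite ler_nat.
rewrite /geometric_cdf (limn_series_finite (N := N)); last by move=> k /xN ->.
rewrite (_ : (fun n => _) = (fun n => \sum_(k < N) if k%:R <= x then
    measure_of (parking_mallows q (n := n)) (fun p => first_entry p == k)
    else 0)); last first.
  apply/funext => n; rewrite /cdf_under /measure_of -big_mkcond/=.
  (* On the event that the first entry is at most [x], [inord] does not alter it. *)
  rewrite (partition_big (fun p => inord (first_entry p) : 'I_N)
             (fun k : 'I_N => k%:R <= x))/=; last first.
    move=> p px; rewrite inordK//; apply: contraTT px; rewrite -leqNgt.
    by move=> /xN ->.
  apply: eq_bigr => k kx; apply: eq_bigl => p.
  apply/andP/eqP => [[px /eqP <-]|->]; last by rewrite inord_val.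
  by rewrite inordK//; apply: contraTT px; rewrite -leqNgt => /xN ->.
apply: cvg_big => [|k _]; first exact: add_continuous.
case: ifPn => _; last exact: cvg_cst.
case: k => -[|k] kN /=; last by rewrite subKr; exact: cvg_first_entry.
(* The value [0] has no mass once [n] is positive; the shift skips [n = 0], where [first_entry]
   defaults to [0]. *)
rewrite -cvg_shiftS (_ : (fun n => _) = fun=> 0); first exact: cvg_cst.
apply/funext => n; rewrite /measure_of big_pred0// => p.
by rewrite gtn_eqF ?first_entry_gt0.
Qed.
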